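(* Let $H$ be a $K$-bialgebra and $A$ an $H$-module-algebra. Let $d^n_{\mathrm{CH}}:\mathrm{CH}^n_{\mathrm{Hopf}}(A,A)\to\mathrm{CH}^{n+1}_{\mathrm{Hopf}}(A,A)$ be the Hopf-Hochschild differential, and let $d^n:\mathrm{CH}^n_{\mathrm{Hopf}}(A,A)\to\mathrm{CH}^{n+1}_{\mathrm{Hopf}}(A,A)$ be the differential $d^n(f)=\pi\{f\}-(-1)^{n-1}f\{\pi\}$ induced by the multiplication $\pi$. Then the equality $$d^n_{\mathrm{CH}}=(-1)^{n+1}d^n$$ holds for each $n$.
   Context: Conventions. $K$ is a fixed field; vector spaces and tensor products are over $K$. $H$ is a $K$-bialgebra (associative, unital, coassociative, counital) with counit $\varepsilon$ and Sweedler notation $\Delta(b)=\sum b_{(1)}\otimes b_{(2)}$, etc. $A$ is an associative unital $K$-algebra with unit $1$. $A$ is an $H$-module-algebra: $A$ is an $H$-module with $b(a_1a_2)=\sum(b_{(1)}a_1)(b_{(2)}a_2)$ and $b(1)=\varepsilon(b)1$. Write $a_{i,j}=a_i\otimes\cdots\otimes a_j$ for elements of $A$ (empty if $j<i$). Crossed product algebra. $X=A\otimes A\otimes H$ with the associative unital multiplication $(a_1\otimes a_1'\otimes b^1)(a_2\otimes a_2'\otimes b^2)=\sum a_1(b^1_{(1)}a_2)\otimes(b^1_{(3)}a_2')a_1'\otimes b^1_{(2)}b^2$. $A$ is an $X$-module by $(a\otimes a'\otimes b)a_0=a(ba_0)a'$, and $A^{\otimes(n+2)}$ is an $X$-module by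 $(a\otimes a'\otimes b)(a_0\otimes\cdots\otimes a_{n+1})=\sum a(b_{(1)}a_0)\otimes b_{(2)}a_1\otimes\cdots\otimes b_{(n+1)}a_n\otimes(b_{(n+2)}a_{n+1})a'$. Hopf-Hochschild complex. $\mathrm{CB}_n(A)=A^{\otimes(n+2)}$ ($n\ge0$) with $d_n^{\mathrm{CB}}=\sum_{j=0}^n(-1)^j\partial_j:\mathrm{CB}_n(A)\to\mathrm{CB}_{n-1}(A)$, where $\partial_j(a_0\otimes\cdots\otimes a_{n+1})=a_0\otimes\cdots\otimes a_ja_{j+1}\otimes\cdots\otimes a_{n+1}$; this is a chain complex of $X$-modules. The Hopf-Hochschild cochain complex is $(\mathrm{CH}^*_{\mathrm{Hopf}}(A,A),d_{\mathrm{CH}})=\mathrm{Hom}_X((\mathrm{CB}_*(A),d^{\mathrm{CB}}),A)$, i.e. $\mathcal{C}(n)=\mathrm{CH}^n_{\mathrm{Hopf}}(A,A)=\mathrm{Hom}_X(A^{\otimes(n+2)},A)$ and $d^n_{\mathrm{CH}}(f)=f\circ d^{\mathrm{CB}}_{n+1}$. Structure maps. For $f\in\mathcal{C}(k)$, $g_i\in\mathcal{C}(n_i)$, $N_i=n_1+\cdots+n_i$, $N_0=0$, $N=N_k$, define $\gamma(f;g_1,\dots,g_k)\in\mathcal{C}(N)$ by $\gamma(f;g_1,\dots,g_k)(a_{0,N+1})=f(a_0\otimes g_1(1\otimes a_{1,N_1}\otimes1)\otimes\cdots\otimes g_k(1\otimes a_{N_{k-1}+1,N_k}\otimes1)\otimes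 a_{N+1})$ (if $n_i=0$ the corresponding factor is $g_i(1\otimes1)$); $\mathrm{Id}\in\mathcal{C}(1)$ is $\mathrm{Id}(a_0\otimes a_1\otimes a_2)=a_0a_1a_2$; $\pi\in\mathcal{C}(2)$ is $\pi(a_0\otimes a_1\otimes a_2\otimes a_3)=a_0a_1a_2a_3$. Brace operations. For $x\in\mathcal{C}(n)$ put $\deg x=n$, $|x|=n-1$. Define $x\{x_1,\dots,x_n\}=\sum(-1)^{\varepsilon}\gamma(x;\mathrm{Id},\dots,\mathrm{Id},x_1,\mathrm{Id},\dots,\mathrm{Id},x_n,\mathrm{Id},\dots,\mathrm{Id})$, the sum over all substitutions of $x_1,\dots,x_n$ into $\gamma(x;\dots)$ in the given order, with $\varepsilon=\sum_p|x_p|i_p$, where $i_p$ is the total number of inputs of the composite in front of $x_p$ (each preceding $\mathrm{Id}$ counts $1$, each preceding $x_q$ counts $\deg x_q$). An empty sum is $0$. *)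

(* Defs.v *)
From HB Require Import structures.
From mathcomp Require Import all_boot all_order all_algebra.
From mathcomp Require Import mathcomp_extra boolp functions.

Set Implicit Arguments.
Unset Strict Implicit.
Unset Printing Implicit Defensive.

Import GRing.Theory.
Local Open Scope ring_scope.

Section TensorProduct.
Variables (K : fieldType) (V W : lmodType K).

(* A list [:: (v1, w1); ...] stands for the sum of the vi (x) wi; [tensor_eq]
   is the congruence generated by the defining relations of the tensor product
   over K. No coefficients are needed, since c (v (x) w) = (c v) (x) w. *)
Inductive tensor_eq : seq (V * W) -> seq (V * W) -> Prop :=
| teq_refl s : tensor_eq s s
| teq_sym s t : tensor_eq s t -> tensor_eq t s
| teq_trans s t u : tensor_eq s t -> tensor_eq t u -> tensor_eq s u
| teq_cat s s' t t' :
    tensor_eq s s' -> tensor_eq t t' -> tensor_eq (s ++ t) (s' ++ t')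
| teq_comm s t : tensor_eq (s ++ t) (t ++ s)
| teq_zero w : tensor_eq [:: (0, w)] [::]
| teq_addl v v' w : tensor_eq [:: (v + v', w)] [:: (v, w); (v', w)]
| teq_addr v w w' : tensor_eq [:: (v, w + w')] [:: (v, w); (v, w')]
| teq_bal c v w : tensor_eq [:: (c *: v, w)] [:: (v, c *: w)].

Definition tensor_eqb (s t : seq (V * W)) : bool := `[< tensor_eq s t >].

Lemma tensor_eqb_equiv : equiv_class_of tensor_eqb.
Proof.
split; first by move=> s; apply/asboolP/teq_refl.
  by move=> s t; apply/asboolP/asboolP; exact: teq_sym.
by move=> s t u /asboolP h /asboolP h'; apply/asboolP; exact: teq_trans h h'.
Qed.

Canonical tensor_equiv := EquivRelPack tensor_eqb_equiv.

Definition tensor := {eq_quot tensor_equiv}%qT.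

HB.instance Definition _ := Choice.on tensor.
HB.instance Definition _ := EqQuotient.on tensor.

Definition sum_of (s : seq (V * W)) : tensor := (\pi_tensor s)%qT.
Definition pure (v : V) (w : W) : tensor := sum_of [:: (v, w)].

Lemma sum_ofP s t : sum_of s = sum_of t <-> tensor_eq s t.
Proof.
split; last by move=> h; apply/eqP; rewrite piE; apply/asboolP.
by move/eqP; rewrite piE => /asboolP.
Qed.

Lemma sum_of_repr (t : tensor) : sum_of (repr t) = t.
Proof. exact: reprK. Qed.

Lemma repr_sum_of s : tensor_eq (repr (sum_of s)) s.
Proof. by apply/sum_ofP; rewrite sum_of_repr. Qed.

Definition scale_seq (c : K) (s : seq (V * W)) := [seq (c *: p.1, p.2) | p <- s].

Definition tensor_zero : tensor := sum_of [::].
Definition tensor_add (s t : tensor) : tensor := sum_of (repr s ++ repr t).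
Definition tensor_scale (c : K) (t : tensor) : tensor :=
  sum_of (scale_seq c (repr t)).
Definition tensor_opp (t : tensor) : tensor := tensor_scale (-1) t.

Lemma scale_seq_eq c s t : tensor_eq s t ->
  tensor_eq (scale_seq c s) (scale_seq c t).
Proof.
elim=> [*|*|s' t' u' _ h _ h'|s1 s2 t1 t2 _ h _ h'|s' t'|w|v v' w|v w w'|d v w].
- exact: teq_refl.
- exact: teq_sym.
- exact: teq_trans h h'.
- by rewrite /scale_seq !map_cat; exact: teq_cat.
- by rewrite /scale_seq !map_cat; exact: teq_comm.
- by rewrite /= scaler0; exact: teq_zero.
- by rewrite /= scalerDr; exact: teq_addl.
- exact: teq_addr.
- by rewrite /= scalerA mulrC -scalerA; exact: teq_bal.
Qed.

Lemma tensor_addE s t : tensor_add (sum_of s) (sum_of t) = sum_of (s ++ t).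
Proof. by apply/sum_ofP/teq_cat; exact: repr_sum_of. Qed.

Lemma tensor_scaleE c s : tensor_scale c (sum_of s) = sum_of (scale_seq c s).
Proof. by apply/sum_ofP/scale_seq_eq; exact: repr_sum_of. Qed.

Lemma tensor_addA : associative tensor_add.
Proof.
move=> x y z; rewrite -[x]sum_of_repr -[y]sum_of_repr -[z]sum_of_repr.
by rewrite !tensor_addE catA.
Qed.

Lemma tensor_addC : commutative tensor_add.
Proof. by move=> x y; apply/sum_ofP/teq_comm. Qed.

Lemma tensor_add0 : left_id tensor_zero tensor_add.
Proof. by move=> x; rewrite -[x]sum_of_repr tensor_addE. Qed.

Lemma scale_seqD c d s :
  tensor_eq (scale_seq (c + d) s) (scale_seq c s ++ scale_seq d s).
Proof.
elim: s => [|[v w] s ih] /=; first exact: teq_refl.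
rewrite scalerDl.
apply: (teq_trans (t := [:: (c *: v, w); (d *: v, w)] ++
                        (scale_seq c s ++ scale_seq d s))).
  exact: (teq_cat (teq_addl _ _ _) ih).
apply: (teq_cat (s := [:: _]) (s' := [:: _]) (teq_refl _)).
have := teq_cat (teq_comm [:: (d *: v, w)] (scale_seq c s))
  (teq_refl (scale_seq d s)).
by rewrite -!catA.
Qed.

Lemma tensor_scaleDl t : {morph tensor_scale^~ t : c d / c + d >-> tensor_add c d}.
Proof.
move=> c d; rewrite -[t]sum_of_repr !tensor_scaleE tensor_addE.
exact/sum_ofP/scale_seqD.
Qed.

Lemma tensor_scale1 : left_id 1 tensor_scale.
Proof.
move=> t; rewrite -[t]sum_of_repr tensor_scaleE; congr sum_of.
by rewrite -[RHS]map_id; apply: eq_map => -[v w]; rewrite /= scale1r.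
Qed.

Lemma tensor_scale0 t : tensor_scale 0 t = tensor_zero.
Proof.
rewrite -[t]sum_of_repr tensor_scaleE; apply/sum_ofP.
elim: (repr t) => [|[v w] s ih] /=; first exact: teq_refl.
by rewrite scale0r; exact: (teq_cat (teq_zero _) ih).
Qed.

Lemma tensor_addN : left_inverse tensor_zero tensor_opp tensor_add.
Proof.
move=> t; rewrite /tensor_opp -[X in tensor_add _ X]tensor_scale1.
by rewrite -tensor_scaleDl addNr tensor_scale0.
Qed.

HB.instance Definition _ := GRing.isZmodule.Build tensor
  tensor_addA tensor_addC tensor_add0 tensor_addN.

Lemma tensor_scaleA c d t :
  tensor_scale c (tensor_scale d t) = tensor_scale (c * d) t.
Proof.
rewrite -[t]sum_of_repr !tensor_scaleE; congr sum_of.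
by rewrite /scale_seq -map_comp; apply: eq_map => p /=; rewrite scalerA.
Qed.

Lemma tensor_scaleDr : right_distributive tensor_scale tensor_add.
Proof.
move=> c s t; rewrite -[s]sum_of_repr -[t]sum_of_repr tensor_addE.
rewrite !tensor_scaleE tensor_addE; congr sum_of.
by rewrite /scale_seq map_cat.
Qed.

HB.instance Definition _ := GRing.Zmodule_isLmodule.Build K tensor
  tensor_scaleA tensor_scale1 tensor_scaleDr tensor_scaleDl.

Lemma sum_of_cat s t : sum_of (s ++ t) = sum_of s + sum_of t.
Proof. exact/esym/tensor_addE. Qed.

Lemma sum_of_scale c s : c *: sum_of s = sum_of (scale_seq c s).
Proof. exact: tensor_scaleE. Qed.

Lemma sum_ofE s : sum_of s = \sum_(p <- s) pure p.1 p.2.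
Proof.
elim: s => [|[v w] s ih]; first by rewrite big_nil.
by rewrite big_cons -ih -sum_of_cat.
Qed.

Lemma tensor_repr (t : tensor) : t = \sum_(p <- repr t) pure p.1 p.2.
Proof. by rewrite -sum_ofE sum_of_repr. Qed.

Lemma pure_linearl w : linear (pure^~ w).
Proof.
move=> c v v'; rewrite sum_of_scale -sum_of_cat.
exact/sum_ofP/teq_addl.
Qed.

Lemma pure_linearr v : linear (pure v).
Proof.
move=> c w w'; rewrite sum_of_scale -sum_of_cat; apply/sum_ofP.
apply: teq_trans (teq_addr _ _ _) _; rewrite -cat1s -[X in tensor_eq _ X]cat1s.
apply: teq_cat (teq_refl _); exact/teq_sym/teq_bal.
Qed.

End TensorProduct.

Notation "V '⊗' W" := (tensor V W) (at level 40, left associativity) : type_scope.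
Notation "v '⊗' w" := (pure v w) (at level 40, left associativity) : ring_scope.

Section Linear.
Variables (K : fieldType) (U V : lmodType K) (f : U -> V).
Hypothesis lf : linear f.

Lemma lin0 : f 0 = 0.
Proof. by have := lf (-1) 0 0; rewrite scaler0 addr0 scaleN1r addNr. Qed.

Lemma linD u v : f (u + v) = f u + f v.
Proof. by have := lf 1 u v; rewrite !scale1r. Qed.

Lemma linZ c u : f (c *: u) = c *: f u.
Proof. by have := lf c u 0; rewrite !addr0 lin0 addr0. Qed.

Lemma lin_sum (I : Type) (r : seq I) (F : I -> U) :
  f (\sum_(i <- r) F i) = \sum_(i <- r) f (F i).
Proof.
elim: r => [|i r ih]; first by rewrite !big_nil lin0.
by rewrite !big_cons linD ih.
Qed.

End Linear.

Section Sums.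
Variables (K : fieldType) (V W : lmodType K).

Definition bilin (U : lmodType K) (phi : V -> W -> U) :=
  (forall w, linear (phi^~ w)) /\ (forall v, linear (phi v)).

(* For an expression t = sum_i vi (x) wi, chosen once and for all for each t,
   [tsum t phi] is sum_i phi vi wi; if phi is bilinear this does not depend on
   the expression (tsum_sum_of), so that t |-> tsum t phi is the linear map
   V (x) W -> U induced by phi (tsum_linear, tsum_pure). *)
Definition tsum (U : lmodType K) (t : (V ⊗ W)%type) (phi : V -> W -> U) : U :=
  \sum_(p <- repr t) phi p.1 p.2.

End Sums.

Notation "'\tsum_' ( v , w <- t ) F" := (tsum t (fun v w => F))
  (at level 41, v name, w name, t at level 10, F at level 41,
   format "'[' \tsum_ ( v ,  w  <-  t ) '/  '  F ']'") : ring_scope.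

Section SumTheory.
Variables (K : fieldType) (V W : lmodType K).
Implicit Types U : lmodType K.

Lemma tensor_eq_sum U (phi : V -> W -> U) s t : bilin phi -> tensor_eq s t ->
  \sum_(p <- s) phi p.1 p.2 = \sum_(p <- t) phi p.1 p.2.
Proof.
move=> [ll lr]; elim=> [//|//|s' t' u _ -> _ -> //|s1 s2 t1 t2 _ h _ h'|s' t'|w|
  v v' w|v w w'|c v w]; rewrite ?big_cat ?big_cons ?big_nil /= ?addr0.
- by rewrite h h'.
- by rewrite addrC.
- exact: (lin0 (ll w)).
- exact: (linD (ll w)).
- exact: (linD (lr v)).
- by rewrite (linZ (ll w)) (linZ (lr v)).
Qed.

Lemma tsum_sum_of U (phi : V -> W -> U) s : bilin phi ->
  tsum (sum_of s) phi = \sum_(p <- s) phi p.1 p.2.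
Proof. by move=> bphi; apply: (tensor_eq_sum bphi); exact: repr_sum_of. Qed.

Lemma tsum_pure U (phi : V -> W -> U) v w : bilin phi ->
  tsum (v ⊗ w) phi = phi v w.
Proof. by move=> bphi; rewrite tsum_sum_of // big_cons big_nil addr0. Qed.

Lemma tsum_linear U (phi : V -> W -> U) : bilin phi -> linear (fun t => tsum t phi).
Proof.
move=> bphi c s t; rewrite -[s in LHS]sum_of_repr -[t in LHS]sum_of_repr.
rewrite sum_of_scale -sum_of_cat tsum_sum_of // big_cat big_map /=; congr (_ + _).
rewrite /tsum scaler_sumr; apply: eq_bigr => p _.
by rewrite (linZ (bphi.1 p.2)).
Qed.

Lemma eq_tsum U (phi psi : V -> W -> U) t : phi =2 psi -> tsum t phi = tsum t psi.
Proof. by move=> e; apply: eq_bigr => p _; exact: e. Qed.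

Lemma lin_tsum U U' (f : U -> U') (phi : V -> W -> U) t : linear f ->
  f (tsum t phi) = \tsum_(v, w <- t) f (phi v w).
Proof. by move=> lf; rewrite (lin_sum lf). Qed.

Lemma tsum_lin U U' (phi : U' -> V -> W -> U) t :
  (forall v w, linear (fun u => phi u v w)) ->
  linear (fun u => \tsum_(v, w <- t) phi u v w).
Proof.
move=> lphi c u u'; rewrite /tsum scaler_sumr -big_split /=.
by apply: eq_bigr => p _; exact: lphi.
Qed.

Lemma tsum_pure_id (t : (V ⊗ W)%type) : \tsum_(v, w <- t) v ⊗ w = t.
Proof. by rewrite /tsum -tensor_repr. Qed.

Lemma bilin_pure : bilin (@pure K V W).
Proof. by split=> u; [exact: pure_linearl | exact: pure_linearr]. Qed.

Lemma tensor_ext U (f g : (V ⊗ W)%type -> U) : linear f -> linear g ->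
  (forall v w, f (v ⊗ w) = g (v ⊗ w)) -> f =1 g.
Proof.
move=> lf lg e t; rewrite -(tsum_pure_id t) !lin_tsum //.
exact: eq_tsum.
Qed.

End SumTheory.

Lemma tsum_exch (K : fieldType) (V W V' W' U : lmodType K)
    (s : (V ⊗ W)%type) (t : (V' ⊗ W')%type) (phi : V -> W -> V' -> W' -> U) :
  \tsum_(v, w <- s) \tsum_(x, y <- t) phi v w x y =
  \tsum_(x, y <- t) \tsum_(v, w <- s) phi v w x y.
Proof. exact: exchange_big. Qed.

Section TensorMap.
Variables (K : fieldType) (V W V' W' : lmodType K) (f : V -> V') (g : W -> W').

Definition tmap (t : (V ⊗ W)%type) : (V' ⊗ W')%type := \tsum_(v, w <- t) f v ⊗ g w.

Hypotheses (lf : linear f) (lg : linear g).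

Lemma tmap_bilin : bilin (fun v w => f v ⊗ g w).
Proof.
split=> [w c v v'|v c w w'] /=; first by rewrite lf pure_linearl.
by rewrite lg pure_linearr.
Qed.

Lemma tmap_linear : linear tmap.
Proof. exact: tsum_linear tmap_bilin. Qed.

Lemma tmap_pure v w : tmap (v ⊗ w) = f v ⊗ g w.
Proof. exact: tsum_pure tmap_bilin. Qed.

End TensorMap.

Definition tmul (K : fieldType) (A B : algType K) (s t : (A ⊗ B)%type) :
    (A ⊗ B)%type :=
  \tsum_(a, b <- s) \tsum_(a', b' <- t) (a * a') ⊗ (b * b').

Definition tassoc (K : fieldType) (U V W : lmodType K) (t : ((U ⊗ V) ⊗ W)%type) :
    (U ⊗ (V ⊗ W))%type :=
  \tsum_(s, w <- t) \tsum_(u, v <- s) u ⊗ (v ⊗ w).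

HB.mixin Record isBialgebra (K : fieldType) H of GRing.Algebra K H := {
  coprod : H -> (H ⊗ H)%type;
  counit : H -> K;
  coprod_linear : linear coprod;
  counit_linear : scalar counit;
  coprodA : forall b : H,
    tassoc (tmap coprod id (coprod b)) = tmap id coprod (coprod b);
  counitl : forall b : H, \tsum_(x, y <- coprod b) counit x *: y = b;
  counitr : forall b : H, \tsum_(x, y <- coprod b) counit y *: x = b;
  coprod1 : coprod 1 = 1 ⊗ 1;
  coprodM : forall b c : H, coprod (b * c) = tmul (coprod b) (coprod c);
  counit1 : counit 1 = 1;
  counitM : forall b c : H, counit (b * c) = counit b * counit c
}.

#[short(type="bialgType")]
HB.structure Definition Bialgebra (K : fieldType) :=
  {H of GRing.Algebra K H & isBialgebra K H}.

(* A unital associative K-algebra, as a ring with a central morphism from K.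
   Unlike algType, this allows the zero algebra. *)
Record pzAlgebra (K : fieldType) := PzAlgebra {
  alg_ring : pzRingType;
  alg_unit : {rmorphism K -> alg_ring};
  alg_central : forall (c : K) (a : alg_ring), alg_unit c * a = a * alg_unit c
}.

Definition alg_sort (K : fieldType) (A : pzAlgebra K) : Type := alg_ring A.
Coercion alg_sort : pzAlgebra >-> Sortclass.

HB.instance Definition _ (K : fieldType) (A : pzAlgebra K) :=
  GRing.PzRing.copy (alg_sort A) (alg_ring A).

Section PzAlgebraTheory.
Variables (K : fieldType) (A : pzAlgebra K).

Definition alg_scale (c : K) (a : A) : A := (alg_unit A c : A) * a.

Lemma alg_scaleA c d a : alg_scale c (alg_scale d a) = alg_scale (c * d) a.
Proof. by rewrite /alg_scale mulrA -rmorphM. Qed.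

Lemma alg_scale1 : left_id 1 alg_scale.
Proof. by move=> a; rewrite /alg_scale rmorph1 mul1r. Qed.

Lemma alg_scaleDr : right_distributive alg_scale +%R.
Proof. by move=> c a b; exact: mulrDr. Qed.

Lemma alg_scaleDl a : {morph alg_scale^~ a : c d / c + d}.
Proof. by move=> c d; rewrite /alg_scale rmorphD mulrDl. Qed.

HB.instance Definition _ := GRing.Zmodule_isLmodule.Build K (alg_sort A)
  alg_scaleA alg_scale1 alg_scaleDr alg_scaleDl.

Lemma alg_scaleAl (c : K) (a b : A) : c *: (a * b) = c *: a * b.
Proof. exact: mulrA. Qed.

Lemma alg_scaleAr (c : K) (a b : A) : c *: (a * b) = a * (c *: b).
Proof.
by rewrite alg_scaleAl [RHS]mulrA; congr (_ * b); exact: alg_central.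
Qed.

Lemma mull_linear (a : A) : linear (fun b : A => a * b).
Proof. by move=> c b b'; rewrite mulrDr alg_scaleAr. Qed.

Lemma mulr_linear (a : A) : linear (fun b : A => b * a).
Proof. by move=> c b b'; rewrite mulrDl alg_scaleAl. Qed.

End PzAlgebraTheory.

Record modAlgebra (K : fieldType) (H : bialgType K) := ModAlgebra {
  mod_alg :> pzAlgebra K;
  hact : H -> mod_alg -> mod_alg;
  hact_linearl : forall a : mod_alg, linear (hact^~ a);
  hact_linearr : forall b : H, linear (hact b);
  hact1 : forall a : mod_alg, hact 1 a = a;
  hactM : forall (b c : H) (a : mod_alg), hact (b * c) a = hact b (hact c a);
  hact_mul : forall (b : H) (a a' : mod_alg),
    hact b (a * a') = \tsum_(b1, b2 <- coprod b) (hact b1 a * hact b2 a');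
  hact_one : forall b : H, hact b 1 = counit b *: (1 : mod_alg)
}.

Definition tensor_lmod (K : fieldType) (V W : lmodType K) : lmodType K :=
  GRing.Lmodule.clone K (V ⊗ W)%type _.

Definition alg_lmod (K : fieldType) (A : pzAlgebra K) : lmodType K :=
  GRing.Lmodule.clone K A _.

Section TensorPowers.
Variables (K : fieldType) (V : lmodType K).

(* V (x) (V (x) ( ... (V (x) K))) with n factors V; the base K makes the case
   n = 0 the correct one. *)
Fixpoint tpow (n : nat) : lmodType K :=
  if n is n'.+1 then tensor_lmod V (tpow n')
  else GRing.Lmodule.clone K K^o _.

(* pure_pow n v = v 0 (x) v 1 (x) ... (x) v (n - 1) *)
Fixpoint pure_pow (n : nat) (v : nat -> V) : tpow n :=
  if n is n'.+1 then v 0%N ⊗ pure_pow n' (fun i => v i.+1) else (1 : K).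

(* t |-> t (x) v *)
Fixpoint trcons (v : V) (n : nat) : tpow n -> tpow n.+1 :=
  match n with
  | 0 => fun c => v ⊗ c
  | n'.+1 => tmap id (trcons v (n := n'))
  end.

End TensorPowers.

Section ModuleStructure.
Variables (K : fieldType) (H : bialgType K) (A : modAlgebra H).

Local Notation AL := (alg_lmod (mod_alg A)).
Local Notation T := (tpow AL).

(* The diagonal action (see tact_pure); H acts on the base K by the counit. *)
Fixpoint tact (n : nat) (b : H) : T n -> T n :=
  match n with
  | 0 => fun c => counit b *: c
  | n'.+1 => fun t =>
      \tsum_(b1, b2 <- coprod b) tmap (hact b1) (tact (n := n') b2) t
  end.

Definition lmulT (n : nat) (a : A) : T n.+1 -> T n.+1 :=
  tmap (fun a0 : A => a * a0) id.

Fixpoint rmulT (n : nat) (a : A) : T n.+1 -> T n.+1 :=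
  match n with
  | 0 => tmap (fun a0 : A => a0 * a) id
  | n'.+1 => tmap id (rmulT (n := n') a)
  end.

(* The underlying space of the crossed product algebra X. As X is unital and
   contains K, an X-linear map between X-modules is a K-linear map commuting
   with the action of every element of X, so that Hom_X only involves the
   actions XactA and XactCB below. *)
Definition X : lmodType K := tensor_lmod A (tensor_lmod A H).

(* (a (x) a' (x) b) a0 = a (b a0) a', see XactA_pure *)
Definition XactA (x : X) (a0 : A) : A :=
  \tsum_(a, y <- x) \tsum_(a', b <- y) (a * hact b a0 * a').

Definition CB (n : nat) : lmodType K := T n.+2.

Definition XactCB (n : nat) (x : X) (t : CB n) : CB n :=
  \tsum_(a, y <- x) \tsum_(a', b <- y) rmulT a' (lmulT a (tact b t)).

Definition mulT (m : nat) (t : T m.+2) : T m.+1 :=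
  \tsum_(a0, u <- t) \tsum_(a1, v <- u) (a0 * a1) ⊗ v.

(* The map multiplying the factors j and j + 1 (see face_pure_pow); the value 0
   for j > m is never used. *)
Fixpoint face (j m : nat) : T m.+2 -> T m.+1 :=
  match j, m with
  | 0, _ => @mulT _
  | j'.+1, m'.+1 => tmap id (face j' (m := m'))
  | _, 0 => fun=> 0
  end.

(* d_{n+1} : CB_{n+1} -> CB_n *)
Definition dCB (n : nat) (t : CB n.+1) : CB n :=
  \sum_(j < n.+2) (-1) ^+ j *: face j (m := n.+1) t.

Lemma hact_bilin : bilin (@hact K H A).
Proof. by split; [exact: hact_linearl | exact: hact_linearr]. Qed.

Lemma id_linear (V : lmodType K) : linear (@id V).
Proof. by []. Qed.

Lemma comp_linear (U V W : lmodType K) (g : V -> W) (f : U -> V) :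
  linear g -> linear f -> linear (fun u => g (f u)).
Proof. by move=> lg lf c u v; rewrite lf lg. Qed.

Lemma lin_mull (U : lmodType K) (a : A) (f : U -> A) :
  linear f -> linear (fun u => a * f u).
Proof. by move=> lf c u v; rewrite lf mull_linear. Qed.

Lemma lin_mulr (U : lmodType K) (a : A) (f : U -> A) :
  linear f -> linear (fun u => f u * a).
Proof. by move=> lf c u v; rewrite lf mulr_linear. Qed.

Lemma lin_purel (U V W : lmodType K) (w : W) (f : U -> V) :
  linear f -> linear (fun u => f u ⊗ w).
Proof. by move=> lf c u v; rewrite lf pure_linearl. Qed.

Lemma lin_purer (U V W : lmodType K) (v : V) (f : U -> W) :
  linear f -> linear (fun u => v ⊗ f u).
Proof. by move=> lf c u v'; rewrite lf pure_linearr. Qed.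

Lemma tact_linearr n b : linear (@tact n b).
Proof.
elim: n b => [|n ih] b; first by move=> c u v; rewrite /= scalerDr !scalerA mulrC.
apply: tsum_lin => b1 b2; apply: tmap_linear; last exact: ih.
exact: hact_linearr.
Qed.

Lemma tact_linearl n t : linear (fun b => @tact n b t).
Proof.
elim: n t => [|n ih] t.
  by move=> c b b' /=; rewrite counit_linear scalerDl scalerA.
apply: (comp_linear (g := fun s => tsum s _)); last exact: coprod_linear.
apply: tsum_linear; split=> b; apply: tsum_lin => v w.
  apply: lin_purel.
  exact: hact_linearl.
apply: lin_purer.
exact: ih.
Qed.

Lemma tact_pure n b a (u : T n) :
  @tact n.+1 b (a ⊗ u) = \tsum_(b1, b2 <- coprod b) hact b1 a ⊗ tact b2 u.
Proof.
apply: eq_tsum => b1 b2; apply: tmap_pure; first exact: hact_linearr.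
exact: tact_linearr.
Qed.

Lemma lmulT_linearr n a : linear (@lmulT n a).
Proof. by apply: tmap_linear; [exact: mull_linear | exact: id_linear]. Qed.

Lemma lmulT_pure n a a0 (u : T n) : lmulT a (a0 ⊗ u) = (a * a0) ⊗ u.
Proof. by apply: tmap_pure; [exact: mull_linear | exact: id_linear]. Qed.

Lemma rmulT_linearr n a : linear (@rmulT n a).
Proof.
elim: n => [|n ih]; first by apply: tmap_linear => //; exact: mulr_linear.
exact: tmap_linear.
Qed.

Lemma rmulT_pure0 a a0 (c : T 0) : @rmulT 0 a (a0 ⊗ c) = (a0 * a) ⊗ c.
Proof. by apply: tmap_pure => //; exact: mulr_linear. Qed.

Lemma rmulT_pure n a a0 (u : T n.+1) : @rmulT n.+1 a (a0 ⊗ u) = a0 ⊗ rmulT a u.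
Proof. by apply: tmap_pure => //; exact: rmulT_linearr. Qed.

Lemma lmulT_linearl n t : linear (fun a => @lmulT n a t).
Proof.
apply: tsum_lin => v w.
apply: lin_purel.
exact: mulr_linear.
Qed.

Lemma rmulT_linearl n t : linear (fun a => @rmulT n a t).
Proof.
elim: n t => [|n ih] t.
  apply: tsum_lin => v w.
  apply: lin_purel.
  exact: mull_linear.
apply: tsum_lin => v w.
apply: lin_purer.
exact: ih.
Qed.

Lemma bilin_XactA a a0 : bilin (fun (a' : A) (b : H) => a * hact b a0 * a').
Proof.
split=> [b|a']; cbv beta; first exact: mull_linear.
apply: lin_mulr.
apply: lin_mull.
exact: hact_linearl.
Qed.

Lemma XactA_pure a a' b a0 : XactA (a ⊗ (a' ⊗ b)) a0 = a * hact b a0 * a'.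
Proof.
rewrite /XactA tsum_pure; first by rewrite tsum_pure //; exact: bilin_XactA.
split=> [y|a1]; last by apply: tsum_linear; exact: bilin_XactA.
apply: tsum_lin => v w.
apply: lin_mulr.
exact: mulr_linear.
Qed.

Lemma XactA_linearr x : linear (XactA x).
Proof.
apply: tsum_lin => a y; apply: tsum_lin => a' b.
apply: lin_mulr.
apply: lin_mull.
exact: hact_linearr.
Qed.

Lemma bilin_XactCB n a (t : CB n) : bilin (fun (a' : A) (b : H) => rmulT a' (lmulT a (tact b t))).
Proof.
split=> [b|a']; cbv beta; first exact: rmulT_linearl.
apply: comp_linear; first exact: rmulT_linearr.
apply: comp_linear; first exact: lmulT_linearr.
exact: tact_linearl.
Qed.

Lemma XactCB_pure n a a' b (t : CB n) :
  XactCB (a ⊗ (a' ⊗ b)) t = rmulT a' (lmulT a (tact b t)).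
Proof.
rewrite /XactCB tsum_pure; first by rewrite tsum_pure //; exact: bilin_XactCB.
split=> [y|a1]; last by apply: tsum_linear; exact: bilin_XactCB.
apply: tsum_lin => v w.
apply: comp_linear; first exact: rmulT_linearr.
exact: lmulT_linearl.
Qed.

(* Hom_X (CB_n, A) *)
Definition HomX n : {pred CB n -> A} :=
  [pred f : CB n -> A | `[< linear f /\ (forall x t, f (XactCB x t) = XactA x (f t)) >]].

Arguments HomX n : clear implicits.

Lemma HomX_submod n : submod_closed (HomX n).
Proof.
split=> [|c f g].
  apply/asboolP; split=> [d u v|x t]; first by rewrite scaler0 addr0.
  by rewrite (lin0 (XactA_linearr x)).
move=> /asboolP[lf xf] /asboolP[lg xg].
have E z : (c *: f + g) z = c *: f z + g z by [].
apply/asboolP; split=> [d u v|x t].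
  by rewrite !E lf lg !scalerDr !scalerA [c * d]mulrC addrACA.
by rewrite !E xf xg XactA_linearr.
Qed.

HB.instance Definition _ n :=
  GRing.isSubmodClosed.Build K (CB n -> A) (HomX n) (@HomX_submod n).

Definition CH (n : nat) : Type := {f : CB n -> A | f \in HomX n}.

HB.instance Definition _ n := SubChoice.on (CH n).
HB.instance Definition _ n := [SubChoice_isSubLmodule of CH n by <:].

Lemma sweedlerA (U : lmodType K) (psi : H -> H -> H -> U) (b : H) :
  (forall y z, linear (fun x => psi x y z)) ->
  (forall x z, linear (fun y => psi x y z)) ->
  (forall x y, linear (fun z => psi x y z)) ->
  \tsum_(x, y <- coprod b) \tsum_(x1, x2 <- coprod x) psi x1 x2 y =
  \tsum_(x, y <- coprod b) \tsum_(y1, y2 <- coprod y) psi x y1 y2.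
Proof.
move=> l1 l2 l3.
have b23 x : bilin (psi x) by split=> [z|y]; [exact: l2 | exact: l3].
have bPsi : bilin (fun x s => tsum s (psi x)).
  split=> [s|x]; last exact: tsum_linear.
  by apply: tsum_lin => y z; exact: l1.
have lPsi : linear (fun t => \tsum_(x, s <- t) tsum s (psi x)).
  exact: tsum_linear.
transitivity (\tsum_(x, s <- tassoc (tmap coprod id (coprod b))) tsum s (psi x)).
  rewrite {1}/tmap /tassoc.
  rewrite [X in _ = tsum X _](_ : _ = \tsum_(x, y <- coprod b)
     \tsum_(x1, x2 <- coprod x) x1 ⊗ (x2 ⊗ y)).
    rewrite (lin_tsum _ _ lPsi); apply: eq_tsum => x y.
    rewrite (lin_tsum _ _ lPsi); apply: eq_tsum => x1 x2.
    by rewrite tsum_pure // tsum_pure.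
  have bt : bilin (fun (s : (H ⊗ H)%type) (w : H) => \tsum_(u, v <- s) u ⊗ (v ⊗ w)).
    split=> [w|s]; last first.
      by apply: tsum_lin => u v; apply: lin_purer; exact: pure_linearr.
    apply: tsum_linear; split=> [v|u]; first exact: pure_linearl.
    by apply: lin_purer; exact: pure_linearl.
  rewrite (lin_tsum _ _ (tsum_linear bt)); apply: eq_tsum => x y.
  by rewrite tsum_pure.
rewrite coprodA /tmap (lin_tsum _ _ lPsi); apply: eq_tsum => x y.
by rewrite tsum_pure.
Qed.

Lemma sweedler_counitl (U : lmodType K) (phi : H -> U) (b : H) : linear phi ->
  \tsum_(x, y <- coprod b) counit x *: phi y = phi b.
Proof.
move=> lphi; rewrite -[in RHS](counitl b) (lin_tsum _ _ lphi).
by apply: eq_tsum => x y; rewrite (linZ lphi).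
Qed.

Lemma sweedler_counitr (U : lmodType K) (phi : H -> U) (b : H) : linear phi ->
  \tsum_(x, y <- coprod b) counit y *: phi x = phi b.
Proof.
move=> lphi; rewrite -[in RHS](counitr b) (lin_tsum _ _ lphi).
by apply: eq_tsum => x y; rewrite (linZ lphi).
Qed.

Lemma tpow_ext n (U : lmodType K) (f g : T n.+1 -> U) : linear f -> linear g ->
  (forall a u, f (a ⊗ u) = g (a ⊗ u)) -> f =1 g.
Proof. exact: tensor_ext. Qed.

Lemma tensor_ext3 n (U : lmodType K) (f g : T n.+2 -> U) : linear f -> linear g ->
  (forall a a' u, f (a ⊗ (a' ⊗ u)) = g (a ⊗ (a' ⊗ u))) -> f =1 g.
Proof.
move=> lf lg e; apply: tpow_ext => // v; apply: tpow_ext => //.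
  by apply: comp_linear => //; exact: pure_linearr.
by apply: comp_linear => //; exact: pure_linearr.
Qed.

Lemma tact1 n (t : T n) : tact 1 t = t.
Proof.
elim: n t => [|n ih] t; first by rewrite /= counit1 scale1r.
move: t; apply: (tpow_ext (f := @tact n.+1 1) (g := id));
  [exact: tact_linearr | exact: id_linear |].
move=> a u; rewrite tact_pure coprod1 tsum_pure ?hact1 ?ih //.
split=> b.
  by apply: lin_purel; exact: hact_linearl.
by apply: lin_purer; exact: tact_linearl.
Qed.

Lemma lmulT1 n (t : T n.+1) : lmulT 1 t = t.
Proof.
move: t; apply: (tpow_ext (f := @lmulT n 1) (g := id));
  [exact: lmulT_linearr | exact: id_linear |].
by move=> a u; rewrite lmulT_pure mul1r.
Qed.

Lemma rmulT1 n (t : T n.+1) : rmulT 1 t = t.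
Proof.
elim: n t => [|n ih].
  apply: (tpow_ext (f := @rmulT 0 1) (g := id));
    [exact: rmulT_linearr | exact: id_linear |].
  by move=> a u; rewrite (rmulT_pure0 1 a u) mulr1.
apply: (tpow_ext (f := @rmulT n.+1 1) (g := id));
  [exact: rmulT_linearr | exact: id_linear |].
by move=> a u; rewrite rmulT_pure ih.
Qed.

Lemma HomXP n (f : CB n -> A) : f \in HomX n <->
  [/\ linear f, forall b t, f (tact b t) = hact b (f t),
      forall a t, f (lmulT a t) = a * f t &
      forall a t, f (rmulT a t) = f t * a].
Proof.
split=> [/asboolP[lf xf]|[lf fb fl fr]].
  have fE a a' b t : f (rmulT a' (lmulT a (tact b t))) = a * hact b (f t) * a'.
    by rewrite -XactCB_pure xf XactA_pure.
  split=> // [b t|a t|a t].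
  - by have := fE 1 1 b t; rewrite rmulT1 lmulT1 mul1r mulr1.
  - by have := fE a 1 1 t; rewrite rmulT1 tact1 hact1 mulr1.
  - by have := fE 1 a 1 t; rewrite lmulT1 tact1 hact1 mul1r.
apply/asboolP; split=> // x t; rewrite /XactCB (lin_tsum _ _ lf).
apply: eq_tsum => a y; rewrite (lin_tsum _ _ lf); apply: eq_tsum => a' b.
by rewrite fr fl fb.
Qed.

Lemma tmapT_linear m n (f : A -> A) (g : T m -> T n) :
  linear f -> linear g -> linear (tmap f g : T m.+1 -> T n.+1).
Proof. exact: (@tmap_linear K AL (T m) AL (T n)). Qed.

Lemma mulT_bilin m a : bilin (fun (a1 : A) (v : T m) => (a * a1) ⊗ v).
Proof.
split=> [v|b]; last exact: pure_linearr.
by apply: lin_purel; exact: mull_linear.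
Qed.

Lemma mulT_bilin2 m :
  bilin (fun (a0 : A) (u : T m.+1) => \tsum_(a1, v <- u) (a0 * a1) ⊗ v).
Proof.
split=> [v|a].
  by apply: tsum_lin => b w; apply: lin_purel; exact: mulr_linear.
exact: (tsum_linear (@mulT_bilin m a)).
Qed.

Lemma mulT_linear m : linear (@mulT m).
Proof. exact: (tsum_linear (@mulT_bilin2 m)). Qed.

Lemma mulT_pure m a0 a1 (u : T m) : mulT (a0 ⊗ (a1 ⊗ u)) = (a0 * a1) ⊗ u.
Proof.
rewrite /mulT (tsum_pure _ _ (@mulT_bilin2 m)).
by rewrite (tsum_pure _ _ (@mulT_bilin m a0)).
Qed.

Lemma faceS_linear (m n : nat) : linear (fun _ : T m => 0 : T n).
Proof. by move=> c u v; rewrite addr0 scaler0. Qed.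

Lemma face_linear j m : linear (@face j m).
Proof.
elim: j m => [|j ih] m; first by case: m => [|m]; exact: mulT_linear.
case: m => [|m]; first exact: faceS_linear.
by apply: tmapT_linear; [exact: id_linear | exact: ih].
Qed.

Lemma face0E m (t : T m.+2) : face 0 t = mulT t.
Proof. by case: m t. Qed.

Lemma face_pure j m a (u : T m.+2) : @face j.+1 m.+1 (a ⊗ u) = a ⊗ face j u.
Proof.
apply: (@tmap_pure K AL (T m.+2) AL (T m.+1)); first exact: id_linear.
exact: face_linear.
Qed.

Lemma mulT_tact m b (t : T m.+2) : mulT (tact b t) = tact b (mulT t).
Proof.
move: t; apply: tensor_ext3.
- by apply: comp_linear; [exact: mulT_linear | exact: tact_linearr].
- by apply: comp_linear; [exact: tact_linearr | exact: mulT_linear].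
move=> a0 a1 u; rewrite mulT_pure !tact_pure.
transitivity (\tsum_(x, y <- coprod b) \tsum_(y1, y2 <- coprod y)
    (hact x a0 * hact y1 a1) ⊗ tact y2 u).
  rewrite (lin_tsum _ _ (@mulT_linear _)); apply: eq_tsum => x y.
  rewrite tact_pure (lin_tsum _ _ (pure_linearr _)).
  rewrite (lin_tsum _ _ (@mulT_linear _)); apply: eq_tsum => y1 y2.
  exact: mulT_pure.
rewrite -(sweedlerA (psi := fun x y z => (hact x a0 * hact y a1) ⊗ tact z u)).
- apply: eq_tsum => x y.
  by rewrite hact_mul (lin_tsum _ _ (pure_linearl _)).
- by move=> y z; apply: lin_purel; apply: lin_mulr; exact: hact_linearl.
- by move=> x z; apply: lin_purel; apply: lin_mull; exact: hact_linearl.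
- by move=> x y; apply: lin_purer; exact: tact_linearl.
Qed.

Lemma mulT_lmulT m a (t : T m.+2) : mulT (lmulT a t) = lmulT a (mulT t).
Proof.
move: t; apply: tensor_ext3.
- by apply: comp_linear; [exact: mulT_linear | exact: lmulT_linearr].
- by apply: comp_linear; [exact: lmulT_linearr | exact: mulT_linear].
by move=> a0 a1 u; rewrite mulT_pure !lmulT_pure mulT_pure mulrA.
Qed.

Lemma mulT_rmulT m a (t : T m.+2) : mulT (rmulT a t) = rmulT a (mulT t).
Proof.
move: t; apply: tensor_ext3.
- by apply: comp_linear; [exact: mulT_linear | exact: rmulT_linearr].
- by apply: comp_linear; [exact: rmulT_linearr | exact: mulT_linear].
move=> a0 a1; case: m => [|m] u; rewrite mulT_pure.
  by rewrite rmulT_pure !rmulT_pure0 mulT_pure mulrA.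
by rewrite !rmulT_pure mulT_pure.
Qed.

Lemma face_tact j m b (t : T m.+2) : (j <= m)%N ->
  face j (tact b t) = tact b (face j t).
Proof.
elim: j m b t => [|j ih] m b t jm; first by rewrite !face0E mulT_tact.
case: m t jm => // m t jm; move: t.
apply: (tpow_ext (f := fun t => @face j.+1 m.+1 (tact b t))
  (g := fun t => tact b (@face j.+1 m.+1 t))).
- by apply: comp_linear; [exact: face_linear | exact: tact_linearr].
- by apply: comp_linear; [exact: tact_linearr | exact: face_linear].
move=> a u; rewrite (@face_pure j m) !tact_pure.
rewrite (lin_tsum _ _ (@face_linear j.+1 m.+1)).
by apply: eq_tsum => b1 b2; rewrite (@face_pure j m) ih.
Qed.

Lemma face_lmulT j m a (t : T m.+2) : (j <= m)%N ->
  face j (lmulT a t) = lmulT a (face j t).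
Proof.
elim: j m a t => [|j ih] m a t jm; first by rewrite !face0E mulT_lmulT.
case: m t jm => // m t jm; move: t.
apply: (tpow_ext (f := fun t => @face j.+1 m.+1 (lmulT a t))
  (g := fun t => lmulT a (@face j.+1 m.+1 t))).
- by apply: comp_linear; [exact: face_linear | exact: lmulT_linearr].
- by apply: comp_linear; [exact: lmulT_linearr | exact: face_linear].
by move=> a0 u; rewrite (@face_pure j m) !lmulT_pure (@face_pure j m).
Qed.

Lemma face_rmulT j m a (t : T m.+2) : (j <= m)%N ->
  face j (rmulT a t) = rmulT a (face j t).
Proof.
elim: j m a t => [|j ih] m a t jm; first by rewrite !face0E mulT_rmulT.
case: m t jm => // m t jm; move: t.
apply: (tpow_ext (f := fun t => @face j.+1 m.+1 (rmulT a t))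
  (g := fun t => rmulT a (@face j.+1 m.+1 t))).
- by apply: comp_linear; [exact: face_linear | exact: rmulT_linearr].
- by apply: comp_linear; [exact: rmulT_linearr | exact: face_linear].
by move=> a0 u; rewrite (@face_pure j m) !rmulT_pure (@face_pure j m) ih.
Qed.

Lemma dCB_linear n : linear (@dCB n).
Proof.
move=> c u v; rewrite /dCB scaler_sumr -big_split; apply: eq_bigr => j _.
by rewrite (@face_linear j n.+1) scalerDr !scalerA mulrC.
Qed.

Lemma lin_dCB n (U : T n.+3 -> T n.+3) (U' : T n.+2 -> T n.+2) t :
  linear U' -> (forall j, (j <= n.+1)%N -> face j (U t) = U' (face j t)) ->
  dCB (U t) = U' (dCB t).
Proof.
move=> lU' e; rewrite /dCB (lin_sum lU'); apply: eq_bigr => j _.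
by rewrite (linZ lU') e // -ltnS.
Qed.

Lemma dCH_subproof n (f : CH n) : (fun t => val f (dCB t)) \in HomX n.+1.
Proof.
have /HomXP[lf fb fl fr] := valP f; apply/HomXP; split=> [|b t|a t|a t].
- by apply: comp_linear; [exact: lf | exact: dCB_linear].
- rewrite (lin_dCB (U' := tact b)) ?fb //; first exact: tact_linearr.
  by move=> j jn; exact: face_tact.
- rewrite (lin_dCB (U' := lmulT a)) ?fl //; first exact: lmulT_linearr.
  by move=> j jn; exact: face_lmulT.
- rewrite (lin_dCB (U' := rmulT a)) ?fr //; first exact: rmulT_linearr.
  by move=> j jn; exact: face_rmulT.
Qed.

Definition dCH (n : nat) (f : CH n) : CH n.+1 :=
  exist _ (fun t => val f (dCB t)) (dCH_subproof f).

End ModuleStructure.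
Arguments HomX {K H} A n.

Section Operad.
Variables (K : fieldType) (H : bialgType K) (A : modAlgebra H).

Local Notation AL := (alg_lmod (mod_alg A)).
Local Notation T := (tpow AL).

(* The tensor product of P, on the first n factors, and Q, on the remaining ones
   (see block_pure_pow). *)
Fixpoint block (n m : nat) (W : lmodType K) (P : T n -> A) (Q : T m.+1 -> W) :
    T (n + m).+1 -> (A ⊗ W)%type :=
  match n return (T n -> A) -> T (n + m).+1 -> (A ⊗ W)%type with
  | 0 => fun P t => P (1 : K) ⊗ Q t
  | n'.+1 => fun P t => \tsum_(a, u <- t) block (fun s => P (a ⊗ s)) Q u
  end P.

Lemma block_linP n m (U W : lmodType K) (P : U -> T n -> A) (Q : T m.+1 -> W) t :
  (forall s, linear (fun x => P x s)) -> linear (fun x => block (P x) Q t).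
Proof.
elim: n P t => [|n ih] P t lP; first by apply: lin_purel; exact: lP.
by apply: tsum_lin => a u; apply: ih => s; exact: lP.
Qed.

Lemma block_linQ n m (U W : lmodType K) (P : T n -> A) (Q : U -> T m.+1 -> W) t :
  (forall s, linear (fun x => Q x s)) -> linear (fun x => block P (Q x) t).
Proof.
move=> lQ; elim: n P t => [|n ih] P t; first by apply: lin_purer; exact: lQ.
by apply: tsum_lin => a u; exact: ih.
Qed.

Lemma block_tsumP n m (U V W : lmodType K) (P : U -> V -> T n -> A)
    (Q : T m.+1 -> W) (s : (U ⊗ V)%type) t :
  block (fun x => \tsum_(u, v <- s) P u v x) Q t =
  \tsum_(u, v <- s) block (P u v) Q t.
Proof.
elim: n P t => [|n ih] P t; first by rewrite /= (lin_tsum _ _ (pure_linearl _)).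
by rewrite /= tsum_exch; apply: eq_tsum => a u; rewrite ih.
Qed.

Lemma block_linear_bilin n m (W : lmodType K) :
  (forall (P : T n -> A) (Q : T m.+1 -> W), linear P -> linear Q ->
     linear (block P Q)) /\
  (forall (P : T n.+1 -> A) (Q : T m.+1 -> W), linear P -> linear Q ->
     bilin (fun (a : A) u => block (fun s : T n => P (a ⊗ s)) Q u)).
Proof.
have step n' : (forall (P : T n' -> A) (Q : T m.+1 -> W), linear P -> linear Q ->
     linear (block P Q)) ->
  (forall (P : T n'.+1 -> A) (Q : T m.+1 -> W), linear P -> linear Q ->
     bilin (fun (a : A) u => block (fun s : T n' => P (a ⊗ s)) Q u)).
  move=> ih P Q lP lQ; split=> [u|a].
    apply: block_linP => s; apply: comp_linear; first exact: lP.
    exact: pure_linearl.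
  apply: ih => //; apply: comp_linear; first exact: lP.
  exact: pure_linearr.
suff h : forall (P : T n -> A) (Q : T m.+1 -> W), linear P -> linear Q ->
     linear (block P Q) by split=> //; exact: step.
elim: n => [|n ih] P Q lP lQ; first by apply: lin_purer; exact: lQ.
by apply: tsum_linear; exact: step.
Qed.

Lemma block_linear n m (W : lmodType K) (P : T n -> A) (Q : T m.+1 -> W) :
  linear P -> linear Q -> linear (block P Q).
Proof. exact: (block_linear_bilin n m W).1. Qed.

Lemma block_pure n m (W : lmodType K) (P : T n.+1 -> A) (Q : T m.+1 -> W) a u :
  linear P -> linear Q ->
  block P Q (a ⊗ u) = block (fun s => P (a ⊗ s)) Q u.
Proof.
by move=> lP lQ; apply: tsum_pure; exact: (block_linear_bilin n m W).2.
Qed.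

Lemma tmap_block n m (W W' : lmodType K) (f : A -> A) (g : W -> W')
    (P : T n -> A) (Q : T m.+1 -> W) t : linear f -> linear g ->
  tmap f g (block P Q t) = block (fun s => f (P s)) (fun s => g (Q s)) t.
Proof.
move=> lf lg; elim: n P t => [|n ih] P t; first exact: (tmap_pure lf lg).
rewrite /= (lin_tsum _ _ (tmap_linear lf lg)).
by apply: eq_tsum => a u; rewrite ih.
Qed.

Lemma block_tact n m (W : lmodType K) (P : T n -> A) (Q : T m.+1 -> W) b t :
  linear P -> linear Q ->
  block P Q (tact b t) = \tsum_(b1, b2 <- coprod b)
    block (fun s => P (tact b1 s)) (fun s => Q (tact b2 s)) t.
Proof.
elim: n P b t => [|n ih] P b t lP lQ.
  transitivity (\tsum_(x, y <- coprod b) counit x *: (P (1 : K) ⊗ Q (tact y t))).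
    rewrite (sweedler_counitl (phi := fun y => P (1 : K) ⊗ Q (tact y t))) //.
    apply: lin_purer; apply: comp_linear; first exact: lQ.
    exact: tact_linearl.
  by apply: eq_tsum => x y; rewrite /= (linZ lP) (linZ (pure_linearl _)).
move: t; apply: (tpow_ext (f := fun t => block P Q (tact b t))
    (g := fun t => \tsum_(b1, b2 <- coprod b)
      block (fun s => P (tact b1 s)) (fun s => Q (tact b2 s)) t)).
- by apply: comp_linear; [exact: block_linear | exact: tact_linearr].
- apply: tsum_lin => x y; apply: block_linear; apply: comp_linear => //;
    exact: tact_linearr.
move=> a u; rewrite tact_pure (lin_tsum _ _ (block_linear lP lQ)).
transitivity (\tsum_(x, y <- coprod b) \tsum_(y1, y2 <- coprod y)
    block (fun s => P (hact x a ⊗ tact y1 s)) (fun s => Q (tact y2 s)) u).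
  apply: eq_tsum => x y; rewrite block_pure // ih //.
  by apply: comp_linear; [exact: lP | exact: pure_linearr].
rewrite -(sweedlerA (psi := fun x y z =>
   block (fun s => P (hact x a ⊗ tact y s)) (fun s => Q (tact z s)) u)).
- apply: eq_tsum => x y; rewrite block_pure; first last.
  + by apply: comp_linear; [exact: lQ | exact: tact_linearr].
  + by apply: comp_linear; [exact: lP | exact: tact_linearr].
  rewrite -block_tsumP; congr (block _ _ u); apply/funext => s.
  by rewrite tact_pure (lin_tsum _ _ lP).
- move=> y z; apply: block_linP => s; apply: comp_linear; first exact: lP.
  by apply: lin_purel; exact: hact_linearl.
- move=> x z; apply: block_linP => s; apply: comp_linear; first exact: lP.
  by apply: lin_purer; exact: tact_linearl.
- move=> x y; apply: block_linQ => s; apply: comp_linear; first exact: lQ.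
  exact: tact_linearl.
Qed.

Lemma block_rmulT n m k (P : T n -> A) (Q : T m.+1 -> T k.+1) a t :
  linear P -> linear Q -> (forall u, Q (rmulT a u) = rmulT a (Q u)) ->
  block P Q (rmulT a t) = rmulT (n := k.+1) a (block P Q t).
Proof.
move=> lP lQ e; elim: n P t lP => [|n ih] P t lP.
  transitivity (P (1 : K) ⊗ rmulT a (Q t)); first by rewrite -e.
  by rewrite -rmulT_pure.
have lb := @block_linear n.+1 m (T k.+1) P Q lP lQ.
move: t; apply: (tpow_ext (f := fun t => block P Q (rmulT (n := (n + m).+1) a t))
  (g := fun t => rmulT (n := k.+1) a (block P Q t))).
- exact: (comp_linear lb (@rmulT_linearr _ _ _ (n.+1 + m) a)).
- exact: (comp_linear (@rmulT_linearr _ _ _ k.+1 a) lb).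
move=> a0 u; rewrite rmulT_pure !block_pure // ih //.
by apply: comp_linear; [exact: lP | exact: pure_linearr].
Qed.

Lemma trcons_linear n (a : A) : linear (trcons (a : AL) (n := n)).
Proof.
elim: n => [|n ih]; first exact: pure_linearr.
exact: (tmapT_linear (@id_linear _ AL) ih).
Qed.

Lemma trcons_pure n (a a0 : A) (u : T n) :
  trcons (a : AL) (n := n.+1) (a0 ⊗ u) = a0 ⊗ trcons (a : AL) u.
Proof.
by apply: (@tmap_pure K AL (T n) AL (T n.+1)); last exact: trcons_linear.
Qed.

Lemma tact_one n b (u : T n) : tact b ((1 : A) ⊗ u : T n.+1) = (1 : A) ⊗ tact b u.
Proof.
rewrite tact_pure -(sweedler_counitl (phi := fun y => (1 : A) ⊗ tact y u)).
  by apply: eq_tsum => x y; rewrite hact_one (linZ (pure_linearl _)).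
by apply: lin_purer; exact: tact_linearl.
Qed.

Lemma trcons_tact n b (t : T n) :
  tact b (trcons (1 : AL) t) = trcons (1 : AL) (tact b t).
Proof.
elim: n b t => [|n ih] b t; first exact: (@tact_one 0).
move: t; apply: (tpow_ext (f := fun t => tact b (trcons (1 : AL) t))
  (g := fun t => trcons (1 : AL) (tact b t))).
- by apply: comp_linear; [exact: tact_linearr | exact: trcons_linear].
- by apply: comp_linear; [exact: trcons_linear | exact: tact_linearr].
move=> a u; rewrite trcons_pure !tact_pure (lin_tsum _ _ (@trcons_linear _ _)).
by apply: eq_tsum => x y; rewrite trcons_pure ih.
Qed.

Definition inner (n : nat) (g : CH A n) (t : T n) : A :=
  val g ((1 : A) ⊗ trcons (1 : AL) t).

Lemma inner_linear n (g : CH A n) : linear (inner g).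
Proof.
have /HomXP[lg _ _ _] := valP g.
apply: comp_linear; first exact: lg.
by apply: lin_purer; exact: trcons_linear.
Qed.

Lemma inner_tact n (g : CH A n) b t : inner g (tact b t) = hact b (inner g t).
Proof.
have /HomXP[_ bg _ _] := valP g.
by rewrite /inner -bg -trcons_tact -tact_one.
Qed.

Definition cochain := {n : nat & CH A n}.

Definition arity (g : cochain) : nat := tag g.

Definition arities (gs : seq cochain) : nat := sumn [seq arity g | g <- gs].

Fixpoint substitute (gs : seq cochain) : T (arities gs).+1 -> T (size gs).+1 :=
  match gs with
  | [::] => id
  | g :: gs' => block (inner (tagged g)) (substitute (gs := gs'))
  end.

Lemma substitute_linear gs : linear (@substitute gs).
Proof.
elim: gs => [|g gs ih]; first exact: id_linear.
by apply: block_linear; first exact: inner_linear.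
Qed.

Lemma substitute_tact gs b t : @substitute gs (tact b t) = tact b (substitute t).
Proof.
elim: gs b t => [//|g gs ih] b t.
have E x y : block (fun s => inner (tagged g) (tact x s))
    (fun s => @substitute gs (tact y s)) t =
  tmap (hact x) (tact y) (block (inner (tagged g)) (@substitute gs) t).
  rewrite tmap_block; [|exact: hact_linearr|exact: tact_linearr].
  by congr (block _ _ t); apply/funext => s; rewrite ?inner_tact ?ih.
rewrite [LHS]block_tact; [|exact: inner_linear|exact: substitute_linear].
by apply: eq_tsum => x y; rewrite E.
Qed.

Lemma substitute_rmulT gs a t :
  @substitute gs (rmulT a t) = rmulT a (substitute t).
Proof.
elim: gs t => [//|g gs ih] t.
by apply: block_rmulT => //; [exact: inner_linear | exact: substitute_linear].
Qed.

Definition castCH (m n : nat) (e : m = n) (f : CH A m) : CH A n :=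
  ecast n (CH A n) e f.

Section Gamma.
Variables (k : nat) (f : CH A k) (gs : seq cochain) (sz : size gs = k).

Definition gamma_fun (t : CB A (arities gs)) : A :=
  val (castCH (esym sz) f) (tmap id (@substitute gs) t).

Lemma gamma_subproof : gamma_fun \in HomX A (arities gs).
Proof.
rewrite /gamma_fun; set f' := castCH _ f.
have /HomXP[lf fb fl fr] := valP f'.
pose S : T (arities gs).+2 -> T (size gs).+2 := tmap id (@substitute gs).
have lS : linear S.
  by apply: tmapT_linear; [exact: id_linear | exact: substitute_linear].
have Sp a u : S (a ⊗ u) = a ⊗ substitute u.
  by apply: (@tmap_pure K AL _ AL); [exact: id_linear | exact: substitute_linear].
have Sb b : (fun t => S (tact b t)) =1 (fun t => tact b (S t)).
  apply: tpow_ext.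
  - by apply: comp_linear; [exact: lS | exact: tact_linearr].
  - by apply: comp_linear; [exact: tact_linearr | exact: lS].
  move=> a u; rewrite Sp !tact_pure (lin_tsum _ _ lS).
  by apply: eq_tsum => x y; rewrite Sp substitute_tact.
have Sl a : (fun t => S (lmulT a t)) =1 (fun t => lmulT a (S t)).
  apply: tpow_ext.
  - by apply: comp_linear; [exact: lS | exact: lmulT_linearr].
  - by apply: comp_linear; [exact: lmulT_linearr | exact: lS].
  by move=> a0 u; rewrite Sp !lmulT_pure Sp.
have Sr a : (fun t => S (rmulT a t)) =1 (fun t => rmulT a (S t)).
  apply: tpow_ext.
  - by apply: comp_linear; [exact: lS | exact: rmulT_linearr].
  - by apply: comp_linear; [exact: rmulT_linearr | exact: lS].
  by move=> a0 u; rewrite Sp !rmulT_pure Sp substitute_rmulT.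
apply/HomXP; split=> [|b t|a t|a t].
- exact: (comp_linear lf lS).
- by rewrite -fb -Sb.
- by rewrite -fl -Sl.
- by rewrite -fr -Sr.
Qed.

(* See gamma_pure_pow for the formula on a_0 (x) ... (x) a_{N+1}. *)
Definition gamma : CH A (arities gs) := exist _ gamma_fun gamma_subproof.

End Gamma.

(* a0 (x) ... (x) a_{n-1} |-> a0 ... a_{n-1} *)
Fixpoint prodT (n : nat) : T n -> A :=
  match n with
  | 0 => fun c : K => c *: (1 : AL)
  | n'.+1 => fun t => \tsum_(a, u <- t) (a * prodT (n := n') u)
  end.

Lemma prodT_linear n : linear (@prodT n).
Proof.
elim: n => [|n ih].
  move=> c u v; rewrite /prodT -[c *: u]/((c * (u : K)) : K).
  by rewrite scalerDl scalerA.
apply: tsum_linear; split=> [u|a]; first exact: mulr_linear.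
by apply: lin_mull.
Qed.

Lemma prodT_pure n a (u : T n) : @prodT n.+1 (a ⊗ u) = a * prodT u.
Proof.
apply: tsum_pure; split=> [v|b]; first exact: mulr_linear.
by apply: lin_mull; exact: prodT_linear.
Qed.

Lemma prodT_tact n b (t : T n) : prodT (tact b t) = hact b (prodT t).
Proof.
elim: n b t => [|n ih] b t.
  rewrite /prodT /tact (linZ (hact_linearr b)) hact_one scalerA.
  by rewrite -[counit b *: t]/(counit b * (t : K)) mulrC.
move: t; apply: (tpow_ext (f := fun t => @prodT n.+1 (tact b t))
  (g := fun t => hact b (@prodT n.+1 t))).
- by apply: comp_linear; [exact: prodT_linear | exact: tact_linearr].
- by apply: comp_linear; [exact: hact_linearr | exact: prodT_linear].
move=> a u; rewrite prodT_pure hact_mul tact_pure.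
rewrite (lin_tsum _ _ (@prodT_linear n.+1)); apply: eq_tsum => x y.
by rewrite prodT_pure ih.
Qed.

Lemma prodT_lmulT n a (t : T n.+1) : prodT (lmulT a t) = a * prodT t.
Proof.
move: t; apply: (tpow_ext (f := fun t => @prodT n.+1 (lmulT a t))
  (g := fun t => a * @prodT n.+1 t)).
- by apply: comp_linear; [exact: prodT_linear | exact: lmulT_linearr].
- by apply: lin_mull; exact: prodT_linear.
by move=> a0 u; rewrite lmulT_pure !prodT_pure mulrA.
Qed.

Lemma prodT_rmulT n a (t : T n.+1) : prodT (rmulT a t) = prodT t * a.
Proof.
elim: n t => [|n ih].
  apply: (tpow_ext (f := fun t => @prodT 1 (rmulT a t))
    (g := fun t => @prodT 1 t * a)).
  - by apply: comp_linear; [exact: prodT_linear | exact: rmulT_linearr].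
  - by apply: lin_mulr; exact: prodT_linear.
  move=> a0 u; rewrite rmulT_pure0 !prodT_pure /prodT -!alg_scaleAr !mulr1.
  by rewrite alg_scaleAl.
apply: (tpow_ext (f := fun t => @prodT n.+2 (rmulT a t))
  (g := fun t => @prodT n.+2 t * a)).
- by apply: comp_linear; [exact: prodT_linear | exact: rmulT_linearr].
- by apply: lin_mulr; exact: prodT_linear.
by move=> a0 u; rewrite rmulT_pure !prodT_pure ih mulrA.
Qed.

Lemma prodT_HomX n : (@prodT n.+2 : CB A n -> A) \in HomX A n.
Proof.
apply/HomXP; split; [exact: prodT_linear | exact: prodT_tact |
  exact: prodT_lmulT | exact: prodT_rmulT].
Qed.

Definition idCH : CH A 1 := exist _ (@prodT 3) (prodT_HomX 1).
Definition piCH : CH A 2 := exist _ (@prodT 4) (prodT_HomX 2).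

Definition mkcochain (n : nat) (f : CH A n) : cochain := Tagged (CH A) f.

(* A Boolean mask marks the slots of gamma(x; ...) filled by the xs, in order;
   the other slots are filled by Id. *)
Fixpoint fill (m : bitseq) (xs : seq cochain) : seq cochain :=
  match m, xs with
  | true :: m', x :: xs' => x :: fill m' xs'
  | _ :: m', _ => mkcochain idCH :: fill m' xs
  | [::], _ => [::]
  end.

(* The sum of the |x_p| i_p, where i is the number of inputs in front of the
   current slot. It is an integer since |x_p| = -1 when x_p has degree 0. *)
Fixpoint fill_sign (m : bitseq) (xs : seq cochain) (i : nat) : int :=
  match m, xs with
  | true :: m', x :: xs' =>
      ((arity x)%:Z - 1) * i%:Z + fill_sign m' xs' (i + arity x)%N
  | _ :: m', _ => fill_sign m' xs i.+1
  | [::], _ => 0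
  end.

Lemma size_fill m xs : size (fill m xs) = size m.
Proof. by elim: m xs => [|[] m ih] [|x xs] //=; rewrite ih. Qed.

Lemma arities_fill m xs : count id m = size xs ->
  (arities (fill m xs) + size xs = size m + arities xs)%N.
Proof.
elim: m xs => [|[] m ih] [|x xs] //= e.
- rewrite /arities /= -/(arities _) -/(arities _) addnS -addnA.
  by rewrite ih ?addSn ?(addnCA (size m)) //; case: e.
- by rewrite /arities /= -/(arities _) -addnA ih.
- by rewrite /arities /= -/(arities _) -addnA ih.
Qed.

Definition masks (k p : nat) : Type := {m : k.-tuple bool | count id m == p}.

HB.instance Definition _ k p := Finite.on (masks k p).

Section Brace.
Variables (k : nat) (x : CH A k) (xs : seq cochain) (N : nat).
Hypothesis degN : (N + size xs = k + arities xs)%N.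

Lemma brace_degree (m : masks k (size xs)) : arities (fill (val m) xs) = N.
Proof.
have := arities_fill (eqP (valP m)); rewrite size_tuple -degN.
exact: addIn.
Qed.

Lemma brace_size (m : masks k (size xs)) : size (fill (val m) xs) = k.
Proof. by rewrite size_fill size_tuple. Qed.

(* x{x_1, ..., x_p}, in degree N = deg x + |x_1| + ... + |x_p| *)
Definition brace : CH A N :=
  \sum_(m : masks k (size xs))
    ((-1 : K) ^ fill_sign (val m) xs 0%N) *:
      castCH (brace_degree m) (gamma x (brace_size m)).

End Brace.

Lemma brace_pi_degree n (f : CH A n) :
  (n.+1 + size [:: mkcochain f] = 2 + arities [:: mkcochain f])%N.
Proof. by rewrite /arities /= addn0 addn1 add2n. Qed.

Lemma brace_mul_degree n :
  (n.+1 + size [:: mkcochain piCH] = n + arities [:: mkcochain piCH])%N.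
Proof. by rewrite /arities /= addn0 addn1 addn2. Qed.

(* f |-> pi{f} - (-1)^(n-1) f{pi} *)
Definition dmul (n : nat) (f : CH A n) : CH A n.+1 :=
  brace piCH (brace_pi_degree f) -
  ((-1 : K) ^ (n%:Z - 1)) *: brace f (brace_mul_degree n).

End Operad.

Section PureTensors.
Variables (K : fieldType) (H : bialgType K) (A : modAlgebra H).

Local Notation AL := (alg_lmod (mod_alg A)).
Local Notation T := (tpow AL).

Lemma eq_pure_pow n (a b : nat -> AL) : (forall i, (i < n)%N -> a i = b i) ->
  pure_pow n a = pure_pow n b.
Proof.
elim: n a b => [//|n ih] a b e /=; rewrite e //.
by congr (_ ⊗ _); apply: ih => i lin; exact: e.
Qed.

Lemma face_pure_pow j m (a : nat -> AL) : (j <= m)%N ->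
  face j (pure_pow m.+2 a : T m.+2) = pure_pow m.+1 (fun i =>
    if (i < j)%N then a i else if i == j then (a j : A) * a j.+1 else a i.+1).
Proof.
elim: j m a => [|j ih] m a jm; first by rewrite face0E mulT_pure.
case: m jm => // m jm.
transitivity (a 0%N ⊗ face j (pure_pow m.+2 (fun i => a i.+1) : T m.+2)).
  exact: face_pure.
rewrite ih //; congr (a 0%N ⊗ _); exact: eq_pure_pow.
Qed.

Lemma trcons_pure_pow n (v : AL) (a : nat -> AL) :
  trcons v (pure_pow n a) = pure_pow n.+1 (fun i => if (i < n)%N then a i else v).
Proof.
elim: n a => [//|n ih] a.
transitivity (a 0%N ⊗ trcons v (pure_pow n (fun i => a i.+1))).
  exact: trcons_pure.
by rewrite ih.
Qed.

Lemma block_pure_pow n m (W : lmodType K) (P : T n -> A) (Q : T m.+1 -> W)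
    (a : nat -> AL) : linear P -> linear Q ->
  block P Q (pure_pow (n + m).+1 a) =
  P (pure_pow n a) ⊗ Q (pure_pow m.+1 (fun i => a (n + i)%N)).
Proof.
elim: n P a => [//|n ih] P a lP lQ.
transitivity (block (fun s => P ((a 0%N : A) ⊗ s)) Q
    (pure_pow (n + m).+1 (fun i => a i.+1))); first exact: block_pure.
rewrite ih //.
by apply: comp_linear; [exact: lP | exact: pure_linearr].
Qed.

Lemma inner_pure_pow n (g : CH A n) (a : nat -> AL) :
  inner g (pure_pow n a) =
  val g (pure_pow n.+2 (fun j => if (0 < j <= n)%N then a j.-1 else 1 : A)).
Proof. by rewrite /inner trcons_pure_pow. Qed.

Lemma substitute_pure_pow (gs : seq (cochain A)) (a : nat -> AL) :
  substitute (gs := gs) (pure_pow (arities gs).+1 a) =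
  pure_pow (size gs).+1 (fun l =>
    if (l < size gs)%N then
      let g := nth (mkcochain (idCH A)) gs l in
      inner (tagged g)
        (pure_pow (tag g) (fun j => a (arities (take l gs) + j)%N))
    else a (arities gs)).
Proof.
elim: gs a => [//|g gs ih] a; set F := (X in _ = pure_pow _ X).
have E := @block_pure_pow _ _ _ (inner (tagged g)) (@substitute _ _ _ gs) a
  (@inner_linear _ _ _ _ _) (@substitute_linear _ _ _ gs).
rewrite [LHS]E ih.
rewrite (@eq_pure_pow (size gs).+1 _ (fun l => F l.+1)) // => l _.
rewrite /F /= ltnS; case: ifP => // _.
by congr (inner _ _); apply: eq_pure_pow => j _; rewrite addnA.
Qed.

(* For g of degree n, inner g a_{1,n} is g (1 (x) a_{1,n} (x) 1) by
   inner_pure_pow. *)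
Lemma gamma_pure_pow k (f : CH A k) (gs : seq (cochain A)) (sz : size gs = k)
    (a : nat -> AL) :
  val (gamma f sz) (pure_pow (arities gs).+2 a) =
  val f (pure_pow k.+2 (fun l =>
    if l == 0%N then a 0%N
    else if (l <= k)%N then
      let g := nth (mkcochain (idCH A)) gs l.-1 in
      inner (tagged g)
        (pure_pow (tag g) (fun j => a (arities (take l.-1 gs) + j).+1))
    else a (arities gs).+1)).
Proof.
case: k / sz f => f; transitivity (val f ((a 0%N : A) ⊗
    substitute (gs := gs) (pure_pow (arities gs).+1 (fun i => a i.+1)))).
  congr (val f _); apply: (@tmap_pure K AL _ AL); first exact: id_linear.
  exact: substitute_linear.
by rewrite substitute_pure_pow.
Qed.

Lemma prodT_pure_pow n (a : nat -> AL) :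
  @prodT _ _ A n (pure_pow n a) = \prod_(i < n) (a i : A).
Proof.
elim: n a => [|n ih] a; first by rewrite big_ord0 /= scale1r.
rewrite big_ord_recl; transitivity ((a 0%N : A) *
    prodT (A := A) (pure_pow n (fun i => a i.+1))); first exact: prodT_pure.
by rewrite ih.
Qed.

Lemma idCH_pure_pow (a : nat -> AL) :
  val (idCH A) (pure_pow 3 a) = (a 0%N : A) * a 1%N * a 2%N.
Proof.
rewrite [LHS](@prodT_pure_pow 3) !big_ord_recr big_ord0 /=.
by rewrite mul1r.
Qed.

Lemma piCH_pure_pow (a : nat -> AL) :
  val (piCH A) (pure_pow 4 a) = (a 0%N : A) * a 1%N * a 2%N * a 3%N.
Proof.
rewrite [LHS](@prodT_pure_pow 4) !big_ord_recr big_ord0 /=.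
by rewrite mul1r.
Qed.

End PureTensors.

(* Main.v *)
(* Both sides are linear in f composed with faces, so they may be compared on
   pure tensors. There pi{f} gives the two outer faces: Id in front of f is the
   face 0, and Id behind f is the face n + 1 (f is left and right A-linear, so
   the factors outside f move in); f{pi} with pi in slot i gives the face i + 1.
   The signs then agree because |pi| = 1 and |f| = n - 1. *)
Require Import Defs.
From mathcomp Require Import all_boot all_order all_algebra.
From mathcomp Require Import boolp zify.

Set Implicit Arguments.
Unset Strict Implicit.
Unset Printing Implicit Defensive.

Import GRing.Theory.
Local Open Scope ring_scope.

(** The degree n - 1 can be -1, hence the integer exponent; as -1 is its own inverse, adding 2 makes
    the exponent natural. *)
Lemma signrz_subr1 (K : fieldType) (n : nat) :
  (-1 : K) ^ (n%:Z - 1) = (-1) ^+ n.+1.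
Proof.
rewrite expfzDr ?oppr_eq0 ?oner_neq0 // exprN1 invrN invr1.
by rewrite -[_ ^ n]/((-1) ^+ n) exprSr.
Qed.

Lemma signrz_subr1M (K : fieldType) (n i : nat) :
  (-1 : K) ^ ((n%:Z - 1) * i%:Z) = (-1) ^+ (n.+1 * i).
Proof. by rewrite -exprz_exp signrz_subr1 exprM. Qed.

Section UnitMask.

(** For a brace with one argument: [true] marks its slot, with [i] copies of [Id] in front and [j]
    behind. *)
Definition unit_mask (i j : nat) : bitseq := nseq i false ++ true :: nseq j false.

Lemma size_unit_mask i j : size (unit_mask i j) = (i + j.+1)%N.
Proof. by rewrite size_cat /= !size_nseq. Qed.

Lemma count_unit_mask i j : count id (unit_mask i j) = 1%N.
Proof. by rewrite count_cat /= !count_nseq /= !mul0n. Qed.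

Lemma find_unit_mask i j : find id (unit_mask i j) = i.
Proof. by rewrite /unit_mask; elim: i => //= i ->. Qed.

Lemma unit_maskP (m : bitseq) : count id m = 1%N ->
  m = unit_mask (find id m) (size m - (find id m).+1).
Proof.
rewrite /unit_mask; elim: m => [//|[] m ih] /= e; last first.
  by rewrite subSS -ih.
rewrite subn1 /=; congr (_ :: _); case: e.
(* The count is used up by the first [true], so the tail is constantly [false]. *)
by elim: m {ih} => [//|[] m ih] //= /ih {1}->.
Qed.

Variable k : nat.

Lemma unit_mask_subproof (i : 'I_k) : size (unit_mask i (k - i.+1)) == k.
Proof. by rewrite size_unit_mask; case: i => i /= ?; apply/eqP; lia. Qed.

Lemma unit_mask_subproof2 (i : 'I_k) :
  count id (Tuple (unit_mask_subproof i)) == 1%N.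
Proof. by rewrite count_unit_mask. Qed.

Definition mask_of_ord (i : 'I_k) : masks k 1 :=
  exist _ (Tuple (unit_mask_subproof i)) (unit_mask_subproof2 i).

(** The inverse is [find id]. This turns the sum over masks in a one-argument [brace] into a sum
    over slots. *)
Lemma mask_of_ord_bij : bijective mask_of_ord.
Proof.
have lt_find (m : masks k 1) : (find id (val m) < k)%N.
  by rewrite -[X in (_ < X)%N](size_tuple (val m)) -has_find has_count (eqP (valP m)).
exists (fun m => Ordinal (lt_find m)).
  by move=> i; apply: val_inj; rewrite /= find_unit_mask.
move=> m; apply: val_inj; apply: val_inj => /=.
by rewrite [RHS]unit_maskP ?(eqP (valP m)) ?size_tuple.
Qed.

End UnitMask.

Section Evaluation.
Variables (K : fieldType) (H : bialgType K) (A : modAlgebra H).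

Local Notation AL := (alg_lmod (mod_alg A)).
Local Notation T := (tpow AL).
Local Notation Id := (mkcochain (idCH A)).

(** Pure tensors span: fixing the first factor leaves a linear map on a shorter tensor power. *)
Lemma tpow_lin_ext n (U : lmodType K) (f g : T n -> U) : linear f -> linear g ->
  (forall a : nat -> AL, f (pure_pow n a) = g (pure_pow n a)) -> f =1 g.
Proof.
elim: n U f g => [|n ih] U f g lf lg e.
  (* The zeroth power is the base field, spanned by the empty pure tensor, so any family serves. *)
  move=> c; have -> : c = c *: (1 : T 0) by exact/esym/mulr1.
  by rewrite (linZ lf) (linZ lg); congr (_ *: _); exact: (e (fun=> 0)).
apply: tpow_ext => // a u.
have lin_tail (h : T n.+1 -> U) : linear h -> linear (fun u : T n => h (a ⊗ u)).
  by move=> lh; apply: comp_linear; [exact: lh | exact: pure_linearr].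
apply: (ih _ (fun u => f (a ⊗ u)) (fun u => g (a ⊗ u))); [exact: lin_tail.. |].
by move=> b; exact: (e (fun i => if i is i'.+1 then b i' else a)).
Qed.

Lemma CH_ext n (f g : CH A n) :
  (forall a : nat -> AL, val f (pure_pow n.+2 a) = val g (pure_pow n.+2 a)) ->
  f = g.
Proof.
have /HomXP[lf _ _ _] := valP f; have /HomXP[lg _ _ _] := valP g.
by move=> e; apply/val_inj/funext; exact: tpow_lin_ext.
Qed.

Lemma val_CHZ n (c : K) (f : CH A n) t : val (c *: f) t = c *: val f t.
Proof. by []. Qed.

Lemma val_CHB n (f g : CH A n) t : val (f - g) t = val f t - val g t.
Proof. by []. Qed.

Lemma val_CH_sum n (I : finType) (F : I -> CH A n) t :
  val (\sum_i F i) t = \sum_i val (F i) t.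
Proof. exact: (big_morph (fun f : CH A n => val f t)). Qed.

Lemma val_castCH m n (e : m = n) (f : CH A m) (a : nat -> AL) :
  val (castCH e f) (pure_pow n.+2 a) = val f (pure_pow m.+2 a).
Proof. by case: n / e. Qed.

Lemma rmulT_pure_pow n (c : A) (a : nat -> AL) :
  rmulT c (pure_pow n.+1 a) =
  pure_pow n.+1 (fun i => if i == n then (a i : A) * c else a i).
Proof.
elim: n a => [|n ih] a; first exact: rmulT_pure0.
transitivity (a 0%N ⊗ rmulT c (pure_pow n.+1 (fun i => a i.+1))).
  exact: rmulT_pure.
by rewrite ih.
Qed.

Lemma lmulT_pure_pow n (c : A) (a : nat -> AL) :
  lmulT c (pure_pow n.+1 a) =
  pure_pow n.+1 (fun i => if i == 0%N then c * (a i : A) else a i).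
Proof. exact: lmulT_pure. Qed.

(** [inner] pads with units on both sides, and left and right A-linearity of [f] restore the outer
    factors. *)
Lemma val_pure_pow_inner n (f : CH A n) (a : nat -> AL) :
  val f (pure_pow n.+2 a) =
  (a 0%N : A) * inner f (pure_pow n (fun j => a j.+1)) * a n.+1.
Proof.
have /HomXP[_ _ fl fr] := valP f.
rewrite inner_pure_pow -fl -fr lmulT_pure_pow rmulT_pure_pow.
congr (val f _); apply: eq_pure_pow => -[|i] lin /=; first by rewrite mulr1.
rewrite eqSS; case: eqP => [->|ni]; first by rewrite ltnn mul1r.
by rewrite ifT //; lia.
Qed.

Lemma inner_idCH (a : nat -> AL) : inner (idCH A) (pure_pow 1 a) = a 0%N.
Proof. by rewrite inner_pure_pow idCH_pure_pow /= mul1r mulr1. Qed.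

Lemma fill_unit_mask i j (y : cochain A) :
  fill (unit_mask i j) [:: y] = nseq i Id ++ y :: nseq j Id.
Proof.
rewrite /unit_mask; elim: i => [|i /= <-] //=.
by congr (_ :: _); elim: j => //= j ->.
Qed.

Lemma fill_sign_unit_mask i j (y : cochain A) s :
  fill_sign (unit_mask i j) [:: y] s = ((arity y)%:Z - 1) * (s + i)%N.
Proof.
rewrite /unit_mask; elim: i s => [|i ih] s /=; last by rewrite ih addSnnS.
have fs0 t : fill_sign (nseq j false) ([::] : seq (cochain A)) t = 0.
  by elim: j t => //= j ih t.
by rewrite fs0 addr0 addn0.
Qed.

Lemma arities_nseq_Id i : arities (nseq i Id) = i.
Proof. by elim: i => //= i; rewrite /arities /= => ->. Qed.

Lemma arities_cat (gs gs' : seq (cochain A)) :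
  arities (gs ++ gs') = (arities gs + arities gs')%N.
Proof. by rewrite /arities map_cat sumn_cat. Qed.

Lemma arities_cons g (gs : seq (cochain A)) :
  arities (g :: gs) = (arity g + arities gs)%N.
Proof. by []. Qed.

(* The arguments of x in gamma(x; Id, ..., y, ..., Id) with i copies of Id in
   front of y; argument 0 is the left coefficient, whence the shift to i + 1. *)
Definition insert_args (y : cochain A) (i : nat) (a : nat -> AL) (l : nat) : AL :=
  if (l <= i)%N then a l
  else if l == i.+1
  then inner (tagged y) (pure_pow (tag y) (fun j => a (i + j).+1))
  else a (l + arity y).-1.

(** The equation on [gs] is a hypothesis because the type of [gamma] depends on [gs]; it is
    rewritten only once [gamma_pure_pow] has removed [gamma]. *)
Lemma val_gamma_insert k (x : CH A k) (y : cochain A) (i j : nat)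
    (gs : seq (cochain A)) (sz : size gs = k) (a : nat -> AL) :
  gs = nseq i Id ++ y :: nseq j Id ->
  val (gamma x sz) (pure_pow (arities gs).+2 a) =
  val x (pure_pow k.+2 (insert_args y i a)).
Proof.
move=> e; rewrite gamma_pure_pow.
have ek : k = (i + j.+1)%N by rewrite -sz e size_cat /= !size_nseq.
rewrite {}e; congr (val x _); apply: eq_pure_pow => -[//|l] lk /=.
rewrite /insert_args; case: ifP => lek; last first.
  (* Here [l = k]: the right coefficient, displaced by [arity y - 1] positions. *)
  rewrite ifN ?ifN; [|lia|lia].
  congr a; rewrite arities_cat arities_cons !arities_nseq_Id; lia.
rewrite nth_cat take_cat size_nseq eqSS; case: ifP => li.
  rewrite nth_nseq li take_nseq ?(ltnW li) // inner_idCH arities_nseq_Id.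
  by rewrite addn0.
case: eqP => [->|ni]; first by rewrite subnn /= cats0 arities_nseq_Id.
(* Slot [l] lies behind [y]; the successor form lets [nth] and [take] step past [y]. *)
have -> : (l - i = (l - i).-1.+1)%N by lia.
rewrite /= nth_nseq if_same arities_cat arities_cons take_nseq; last by lia.
rewrite inner_idCH !arities_nseq_Id; congr a; lia.
Qed.

(** Each [Id] in front of [y] has one input, so the sign exponent is |y| i, and [(arity y).+1] has
    the parity of |y|. *)
Lemma val_brace1 k (x : CH A k) (y : cochain A) (N : nat)
    (degN : (N + size [:: y] = k + arities [:: y])%N) (a : nat -> AL) :
  val (brace x degN) (pure_pow N.+2 a) =
  \sum_(i < k) (-1 : K) ^+ ((arity y).+1 * i) *:
    val x (pure_pow k.+2 (insert_args y i a)).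
Proof.
rewrite val_CH_sum (reindex (@mask_of_ord k)); last first.
  exact: onW_bij (@mask_of_ord_bij k).
apply: eq_bigr => i _.
rewrite fill_sign_unit_mask add0n signrz_subr1M val_CHZ; congr (_ *: _).
rewrite val_castCH; apply: val_gamma_insert; exact: fill_unit_mask.
Qed.

End Evaluation.

Theorem theorem5p5 (K : fieldType) (H : bialgType K) (A : modAlgebra H)
    (n : nat) (f : CH A n) :
  dCH f = (-1 : K) ^+ n.+1 *: dmul f.
Proof.
have /HomXP[lf _ _ _] := valP f.
apply: CH_ext => a; pose t := pure_pow n.+3 a; pose F j := val f (face j t).
transitivity (\sum_(j < n.+2) (-1 : K) ^+ j *: F j).
  by rewrite /= /dCB (lin_sum lf); apply: eq_bigr => j _; exact: linZ.
(* The outer faces are split off; reindexing the inner ones from 0 flips their sign. *)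
transitivity ((-1 : K) ^+ n.+1 *: (F n.+1 + (-1 : K) ^+ n.+1 *: F 0%N -
   (-1 : K) ^+ n.+1 *: \sum_(i < n) (-1 : K) ^+ i *: F i.+1)).
  rewrite big_ord_recl big_ord_recr /= scale1r !scalerDr scalerN !scalerA.
  rewrite -expr2 sqrr_sign !scale1r addrA addrC addrA; congr (_ + _).
  rewrite -sumrN; apply: eq_bigr => i _.
  by rewrite exprS mulN1r scaleNr.
rewrite /dmul signrz_subr1 val_CHZ val_CHB val_CHZ !val_brace1.
have FE j : (j < n.+2)%N -> F j = val f (pure_pow n.+2 (fun i =>
    if (i < j)%N then a i
    else if i == j then (a j : A) * a j.+1 else a i.+1)).
  by move=> jn; rewrite /F /t face_pure_pow.
congr (_ *: (_ - _ *: _)); last first.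
  apply: eq_bigr => i _.
  (* [piCH] has degree 2 and (-1)^3 = -1, so slot [i] carries the sign (-1)^i. *)
  rewrite exprM -[in RHS](signr_odd _ (arity _).+1) expr1.
  rewrite FE ?ltnS ?(ltnW (ltn_ord i)) //; congr (_ *: val f _).
  apply: eq_pure_pow => l ln; rewrite /insert_args ltnS.
  case: ifP => // _; have [_|_] := eqVneq l i.+1; last by rewrite addn2.
  by rewrite inner_pure_pow piCH_pure_pow /= mul1r mulr1 addn0 addn1.
(* The two slots of [piCH] remain: slot 0 matches [F n.+1] with sign 1, slot 1 matches [F 0] with
   sign (-1)^(n+1). *)
rewrite !big_ord_recl big_ord0 !piCH_pure_pow !FE // !val_pure_pow_inner.
rewrite addr0 muln0 muln1 expr0 scale1r /insert_args /= !ltnn !eqxx.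
congr (_ + _ *: _).
  rewrite mulrA add2n; congr (_ * inner f _ * _ * _).
  by apply: eq_pure_pow => j jn; rewrite ltnS jn.
Qed.
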